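(* In the setting of the context, let $\widehat\zeta\neq\zeta$ be an approximation to $\zeta$, and for each $N$ let $\widehat\varphi_n^N$ ($0\le n\le N$) and $\widehat b_n^N$ be computed by backward recurrence from terminal values $\widehat\varphi_N^N$ satisfying $\lambda_Np_N\widehat\varphi_N^N\to 0$ as $N\to\infty$. Assume relative errors are well defined, i.e. $\zeta$, $\varphi_n$, $b_n$ are nonzero wherever they appear as denominators. Then, as $N\to\infty$, for each fixed $n\ge 0$ in (a), (b) and each fixed $n\ge 1$ in (c), (d): (a) $E_{\mathrm{abs}}(\widehat\varphi_n^N)\to -T_{n+1}^-\,E_{\mathrm{abs}}(\widehat\zeta)$; (b) $E_{\mathrm{rel}}(\widehat\varphi_n^N)\to -\zeta\frac{T_{n+1}^-}{\varphi_n}E_{\mathrm{rel}}(\widehat\zeta)=-\frac{\zeta}{Z_{n+1}^--\zeta}E_{\mathrm{rel}}(\widehat\zeta)$; (c) $E_{\mathrm{abs}}(\widehat b_n^N)\to -T_{n0}\,E_{\mathrm{abs}}(\widehat\zeta)$; (d) $E_{\mathrm{rel}}(\widehat b_n^N)\to -\zeta\frac{T_{n0}}{b_n}E_{\mathrm{rel}}(\widehat\zeta)=-\frac{\zeta}{b_0/T_{n0}+Z_{n0}-\zeta}E_{\mathrm{rel}}(\widehat\zeta)$.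
   Context: Let $\{X(t)\}_{t\ge 0}$ be a continuous-time birth--death Markov chain on $\mathbb{N}_0=\{0,1,2,\dots\}$ with birth rates $\lambda_n>0$ ($n\ge 0$), death rates $\mu_n>0$ ($n\ge 1$) and $\mu_0=0$. Set $\pi_0=1$, $\pi_n=\frac{\lambda_0\cdots\lambda_{n-1}}{\mu_1\cdots\mu_n}$ for $n\ge1$. Standing assumption: $\sum_{n\ge 0} 1/(\lambda_n\pi_n)=\infty$ and $\sum_{n\ge 0}\pi_n<\infty$ (the process is uniquely determined by its rates and ergodic). The steady-state probabilities are $p_n=\pi_n/\sum_{j\ge 0}\pi_j$. Cost rates $c_n\in\mathbb{R}$ satisfy $\sum_n |c_n|p_n<\infty$, and $\zeta:=\sum_n c_np_n$. With $\tau_n:=\min\{t\ge 0: X(t)=n\}$ and $\mathbb{E}_n$ the expectation given $X(0)=n$, for $n\ge 1$: $T_n^-:=\mathbb{E}_n[\tau_{n-1}]$, $H_n^-:=\mathbb{E}_n[\int_0^{\tau_{n-1}}c_{X(s)}\,ds]$, $Z_n^-:=H_n^-/T_n^-$, $T_{n0}:=\mathbb{E}_n[\tau_0]$, $H_{n0}:=\mathbb{E}_n[\int_0^{\tau_0}c_{X(s)}\,ds]$, $Z_{n0}:=H_{n0}/T_{n0}$. Exact quantities: $\varphi_0=\frac{\zeta-c_0}{\lambda_0}$, $\varphi_n=\frac{\zeta-c_n}{\lambda_n}+\frac{\mu_n}{\lambda_n}\varphi_{n-1}$ for $n\ge 1$; $b_0\in\mathbb{R}$ is given and $b_n=b_0+\sum_{j=0}^{n-1}\varphi_j$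 (solution of Poisson's equation). Backward recurrence: given the terminal value $\widehat\varphi_N^N\in\mathbb{R}$, $\widehat\varphi_{n-1}^N=\frac{c_n-\widehat\zeta}{\mu_n}+\frac{\lambda_n}{\mu_n}\widehat\varphi_n^N$ for $n=N,N-1,\dots,1$; and $\widehat b_0^N=b_0$, $\widehat b_n^N=b_0+\sum_{j=0}^{n-1}\widehat\varphi_j^N$ for $1\le n\le N$. For an approximation $\widehat x$ to $x$: $E_{\mathrm{abs}}(\widehat x):=\widehat x-x$ and $E_{\mathrm{rel}}(\widehat x):=E_{\mathrm{abs}}(\widehat x)/x$ (if $x\ne 0$). *)

(* Defs.v *)
From HB Require Import structures.
From mathcomp Require Export all_boot all_order all_algebra.
From mathcomp Require Export all_classical all_reals all_analysis.

Set Implicit Arguments.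
Unset Strict Implicit.
Unset Printing Implicit Defensive.

Import Order.TTheory GRing.Theory Num.Theory.
Import numFieldNormedType.Exports.

Local Open Scope classical_set_scope.
Local Open Scope ring_scope.

Definition pi_weight (R : realType) (lam mu : nat -> R) (n : nat) : R :=
  \prod_(0 <= j < n) (lam j / mu j.+1).

Definition steady (R : realType) (lam mu : nat -> R) (n : nat) : R :=
  pi_weight lam mu n / limn (series (pi_weight lam mu)).

Definition mean_cost (R : realType) (lam mu c : nat -> R) : R :=
  limn (series (fun n => c n * steady lam mu n)).

(* Transition probabilities of the embedded jump chain. *)
Definition jump_prob (R : realType) (lam mu : nat -> R) (m m' : nat) : R :=
  if m' == m.+1 then lam m / (lam m + mu m)
  else if m'.+1 == m then mu m / (lam m + mu m)
  else 0.

(* Jump chain / holding time definition of a continuous-time Markov chain (as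
   in Norris, "Markov Chains", section 2.6), for the birth-death rates
   [lam], [mu] and the initial state [i]: the successive states [Y k] form a
   discrete-time Markov chain started at [i], and given those states the
   holding times [S k] are independent and exponential with rate
   [lam (Y k) + mu (Y k)].  The k-th jump occurs at time
   [series (S^~ w) k = S 0 w + ... + S (k-1) w].  Nothing is imposed on [X]
   after a possible explosion, nor at negative times. *)
Definition birth_death_chain (R : realType) (lam mu : nat -> R)
    (d : measure_display) (T : measurableType d) (P : probability T R)
    (X : R -> {mfun T >-> nat}) (i : nat) : Prop :=
  exists (Y : nat -> {mfun T >-> nat}) (S : nat -> {mfun T >-> R}),
  [/\ forall (k : nat) (y : nat -> nat),
        P [set w | forall j, (j <= k)%N -> Y j w = y j] =
        ((y 0%N == i)%:R *
         \prod_(0 <= j < k) jump_prob lam mu (y j) (y j.+1))%:E,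
      forall (k : nat) (y : nat -> nat) (s : nat -> R), (forall j, 0 <= s j) ->
        P [set w | forall j, (j <= k)%N -> Y j w = y j /\ s j < S j w] =
        (P [set w | forall j, (j <= k)%N -> Y j w = y j] *
         (\prod_(0 <= j < k.+1)
            expR (- (lam (y j) + mu (y j)) * s j))%:E)%E
    & {ae P, forall w, forall (k : nat) (t : R),
        series (fun j => S j w) k <= t < series (fun j => S j w) k.+1 ->
        X t w = Y k w}].

(* The hitting time is [+oo] on paths that never visit [m]. *)
Definition hitting_time (R : realType) (T : Type) (X : R -> T -> nat)
    (m : nat) (w : T) : \bar R :=
  ereal_inf [set t%:E | t in [set t : R | 0 <= t /\ X t w = m]].

(* [fine] makes these expectations real numbers; both are finite for a
   positive recurrent birth-death chain started above [m] whose costs are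
   integrable against the steady-state probabilities. *)
Definition mean_hitting_time (R : realType) (d : measure_display)
    (T : measurableType d) (P : probability T R) (X : R -> T -> nat)
    (m : nat) : R :=
  fine (\int[P]_w hitting_time X m w)%E.

Definition mean_hitting_cost (R : realType) (d : measure_display)
    (T : measurableType d) (P : probability T R) (X : R -> T -> nat)
    (c : nat -> R) (m : nat) : R :=
  fine (\int[P]_w
    \int[@lebesgue_measure R]_(s in
        [set s : R | (0 <= s)%R /\ (s%:E < hitting_time X m w)%E])
      (c (X s w))%:E)%E.

Fixpoint phi (R : realType) (lam mu c : nat -> R) (n : nat) : R :=
  (mean_cost lam mu c - c n) / lam n +
  (if n is n'.+1 then mu n / lam n * phi lam mu c n' else 0).

Definition bias_of (R : realType) (b0 : R) (f : nat -> R) (n : nat) : R :=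
  b0 + \sum_(0 <= j < n) f j.

(* Index shifted by one: relates [n] and [n.+1] for [n < N]; the values at
   indices above [N] are unconstrained. *)
Definition backward_recurrence (R : realType) (lam mu c : nat -> R) (zetah : R)
    (N : nat) (f : nat -> R) : Prop :=
  forall n, (n < N)%N ->
    f n = (c n.+1 - zetah) / mu n.+1 + lam n.+1 / mu n.+1 * f n.+1.

Definition Eabs (R : realType) (xh x : R) : R := xh - x.

Definition Erel (R : realType) (xh x : R) : R := Eabs xh x / x.

(* Main.v *)
(* The chain started at [n] and absorbed in [m < n] spends in state [i] a mean
   time [g i] satisfying a second-order balance equation.  Its first integral,
   the flux [lam i * g i - mu i.+1 * g i.+1], is constant beyond [n], equal to
   the escape probability [1 - a]; since [g >= 0] and the series of the
   [1 / (lam i * pi i)] diverges, [a = 1].  So the chain is absorbed almost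
   surely and [g i = pi i * \sum_(m <= j < min i n) 1 / (lam j * pi j)].  For a
   cost rate [f], the mean cost of the passage from [n] to [m] is therefore
   [\sum_(m <= j < n) e_f j] with
   [e_f j = (\sum_(i > j) f i * pi i) / (lam j * pi j)].  Multiplying the two
   recurrences by [lam n * pi n] makes them telescope: the exact values are
   [phi n = e_c n - zeta * e_1 n], and the backward ones tend to
   [e_c n - zetah * e_1 n], with [e_1 n] and [e_c n] the mean duration and cost
   of the passage from [n.+1] to [n]. *)
Require Import Defs.
From HB Require Import structures.
From mathcomp Require Import all_boot all_order all_algebra.
From mathcomp Require Import all_classical all_reals all_analysis.
From mathcomp Require Import measurable_realfun ring lra.

Set Implicit Arguments.
Unset Strict Implicit.
Unset Printing Implicit Defensive.

Import Order.TTheory GRing.Theory Num.Theory.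
Import numFieldNormedType.Exports.
Local Open Scope classical_set_scope.
Local Open Scope ring_scope.

(** * Green function of the absorbed jump chain *)

Section RatesLemmas.
Context {R : realType} {lam mu : nat -> R}.
Hypothesis lam_gt0 : forall n, 0 < lam n.
Hypothesis mu_gt0 : forall n, 0 < mu n.+1.

Lemma pi_weight_gt0 n : 0 < pi_weight lam mu n.
Proof. by apply: prodr_gt0 => i _; rewrite divr_gt0. Qed.

Lemma pi_weight_balance n :
  mu n.+1 * pi_weight lam mu n.+1 = lam n * pi_weight lam mu n.
Proof.
rewrite /pi_weight big_nat_recr//=; have /lt0r_neq0 mu0 := mu_gt0 n.
by field.
Qed.

Section Green.
Variables (m n : nat) (h : nat -> nat -> R).
Hypothesis ltmn : (m < n)%N.
Hypothesis mu_ge0 : 0 <= mu 0%N.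
Hypothesis recurrent :
  series (fun n => 1 / (lam n * pi_weight lam mu n)) @ \oo --> +oo.

(* [v k i] is the expected time spent in [i] between jumps [k] and [k.+1],
   for the chain absorbed in [m], when [h k i] is the probability that it
   occupies [i] after [k] jumps without having visited [m] before. *)
Let v k (i : nat) := if i == m then 0 else h k i / (lam i + mu i).

Hypothesis h_ge0 : forall k i, 0 <= h k i.
Hypothesis h0 : forall i, h 0%N i = (i == n)%:R.
Hypothesis hS : forall k i, h k.+1 i =
  (if i is i'.+1 then lam i' * v k i' else 0) + mu i.+1 * v k i.+1.
Hypothesis h_le1 : forall K, series (h ^~ m) K <= 1.

Let q_gt0 i : 0 < lam i + mu i.
Proof. by case: i => [|i]; rewrite ltr_wpDr// ltW. Qed.

Let v_ge0 k i : 0 <= v k i.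
Proof. by rewrite /v; case: ifP => // _; rewrite divr_ge0// ltW. Qed.

(** Jumps go to nearest neighbours and [v k] vanishes at [m], so no mass started above [m] gets past
    [m]. *)
Let h_low k i : (i < m)%N -> h k i = 0.
Proof.
elim: k i => [|k IH] i im.
  by rewrite h0 (ltn_eqF (ltn_trans im ltmn)).
have v0 j : (j <= m)%N -> v k j = 0.
  rewrite /v leq_eqVlt => /orP[->//|jm].
  by case: ifP => // _; rewrite IH// mul0r.
rewrite hS v0// mulr0 addr0; case: i im => // i im.
by rewrite v0 ?mulr0// ltnW// ltnW.
Qed.

Let v_low k i : (i <= m)%N -> v k i = 0.
Proof.
rewrite /v leq_eqVlt => /orP[->//|im].
by case: ifP => // _; rewrite h_low// mul0r.
Qed.

Let V i K := \sum_(0 <= k < K) v k i.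

Let V_nd i : nondecreasing_seq (V i).
Proof.
by apply: (@nondecreasing_series _ (v ^~ i) xpredT 0%N) => k _ _.
Qed.

Let V_ge0 i K : 0 <= V i K.
Proof. by rewrite /V sumr_ge0. Qed.

Let sum_hS K i : \sum_(0 <= k < K.+1) h k i = (i == n)%:R +
  ((if i is i'.+1 then lam i' * V i' K else 0) + mu i.+1 * V i.+1 K).
Proof.
rewrite big_nat_recl//= h0; congr (_ + _).
under eq_bigr do rewrite hS.
rewrite big_split/= /V; congr (_ + _); last by rewrite mulr_sumr.
by case: (i) => [|i'] /=; [rewrite big1|rewrite mulr_sumr].
Qed.

(** The recurrence summed over time: the mass leaving [j.+1] in [K.+1] steps is the initial unit
    mass plus the inflow of [K] steps, hence the shifted time index. *)
Let V_step K j : (m <= j)%N -> (lam j.+1 + mu j.+1) * V j.+1 K.+1 =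
  (j.+1 == n)%:R + (lam j * V j K + mu j.+2 * V j.+2 K).
Proof.
move=> mj; rewrite -sum_hS /V mulr_sumr; apply: eq_bigr => k _.
rewrite /v gtn_eqF ?ltnS//; have /lt0r_neq0 := q_gt0 j.+1 => ?.
by field.
Qed.

Let sum_hm K : \sum_(0 <= k < K.+1) h k m = mu m.+1 * V m.+1 K.
Proof.
rewrite sum_hS ltn_eqF// add0r; case: (m) v_low => [|m'] vl; first by rewrite add0r.
by rewrite {1}/V big1 ?mulr0 ?add0r// => k _; exact: vl.
Qed.

(** Monotonicity leaves only bounds to find. They climb from [m]: the absorbed mass, at most 1,
    bounds the state [m.+1], and the balance at a state bounds its upper neighbour. *)
Let V_cvg i : cvgn (V i).
Proof.
have [im|] := leqP i m.
  rewrite (_ : V i = cst 0); first exact: is_cvg_cst.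
  by apply/funext => K; rewrite /V big1// => k _; rewrite v_low.
case: i => // i; rewrite ltnS => mi.
suff [M VM] : exists M, forall K, V i.+1 K <= M.
  apply: nondecreasing_is_cvgn => //.
  by exists M => _ [K _ <-].
rewrite -(subnKC mi); elim: (i - m)%N => [|e [M IH]].
  exists (mu m.+1)^-1 => K; rewrite addn0 -[leRHS]mul1r.
  rewrite ler_pdivlMr// mulrC -sum_hm; exact: h_le1.
exists ((lam (m + e).+1 + mu (m + e).+1) * M / mu (m + e).+2) => K.
rewrite addnS ler_pdivlMr//; apply: (@le_trans _ _
  ((lam (m + e).+1 + mu (m + e).+1) * V (m + e).+1 K.+1)); last first.
  by rewrite ler_pM2l.
rewrite V_step ?leq_addr// addrA mulrC lerDr addr_ge0// mulr_ge0//.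
exact: ltW.
Qed.

Let g i := limn (V i).

Let g_cvg i : V i @ \oo --> g i. Proof. exact: V_cvg. Qed.

Let g_ge0 i : 0 <= g i.
Proof.
apply: limr_ge; first exact: V_cvg.
exact: nearW.
Qed.

Let g_low i : (i <= m)%N -> g i = 0.
Proof.
move=> im; rewrite /g (_ : V i = cst 0) ?lim_cst//.
by apply/funext => K; rewrite /V big1// => k _; rewrite v_low.
Qed.

(** The probability of absorption in [m], which is entered only from [m.+1]; see [h_cvg]. *)
Let a := mu m.+1 * g m.+1.

Let h_cvg : series (h ^~ m) @ \oo --> a.
Proof.
rewrite -cvg_shiftS/= (_ : (fun _ => _) = fun K => mu m.+1 * V m.+1 K).
  by apply: cvgM => //; exact: cvg_cst.
by apply/funext => K; rewrite /series/= sum_hm.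
Qed.

Let a_le1 : a <= 1.
Proof.
rewrite -(cvg_lim _ h_cvg)//; apply: limr_le; last exact: nearW.
by apply/cvg_ex; exists a.
Qed.

(* Minus the net flow from [j] to [j.+1]. *)
Let flux j : (m <= j)%N ->
  mu j.+1 * g j.+1 - lam j * g j = a - (n <= j)%N%:R.
Proof.
move=> mj; rewrite -(subnKC mj); elim: (j - m)%N => [|e IH].
  by rewrite addn0 (g_low (leqnn m)) mulr0 subr0 leqNgt ltmn subr0.
rewrite addnS; set i := (m + e)%N in IH *.
have mi : (m <= i)%N by exact: leq_addr.
have E : (lam i.+1 + mu i.+1) * g i.+1 =
    (i.+1 == n)%:R + (lam i * g i + mu i.+2 * g i.+2).
  have /cvg_lim <- // : (fun K => (lam i.+1 + mu i.+1) * V i.+1 K.+1) @ \oo -->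
      (lam i.+1 + mu i.+1) * g i.+1.
    by apply: cvgM; [exact: cvg_cst|rewrite cvg_shiftS].
  apply: cvg_lim => //; under eq_fun do rewrite V_step//.
  by apply: cvgD; [exact: cvg_cst|apply: cvgD; apply: cvgM => //; exact: cvg_cst].
(* The right-hand side drops by 1 exactly when [i.+1 = n], where the unit mass enters. *)
rewrite leq_eqVlt ltnS [n == _]eq_sym.
case: eqVneq E => [nE|_]/=; last by lra.
by move: IH; rewrite -nE ltnn/=; lra.
Qed.

Let r i := 1 / (lam i * pi_weight lam mu i).

(** By [pi_weight_balance], dividing [flux] by [lam j * pi_weight lam mu j] gives the increment from
    [j] to [j.+1] of the ratio of [g] to the weights, a ratio that starts from 0 at [m]. *)
Let g_sum j : (m <= j)%N -> g j =
  pi_weight lam mu j * \sum_(m <= i < j) (a - (n <= i)%N%:R) * r i.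
Proof.
elim: j => [|j IH]; first by rewrite leqn0 => /eqP m0; rewrite -m0 g_low// big_geq// mulr0.
rewrite leq_eqVlt ltnS => /orP[/eqP<-|mj]; first by rewrite g_low// big_geq// mulr0.
rewrite big_nat_recr//= mulrDr -flux//.
have /lt0r_neq0 mu0 := mu_gt0 j; have /lt0r_neq0 la0 := lam_gt0 j.
have /lt0r_neq0 pi0 := pi_weight_gt0 j.
have -> : pi_weight lam mu j.+1 = lam j * pi_weight lam mu j / mu j.+1.
  by rewrite -pi_weight_balance mulrC mulKf.
rewrite [in RHS](_ : _ * _ / _ * \sum_(_ <= _ < _) _ = lam j / mu j.+1 * g j); last first.
  by rewrite IH//; field.
by rewrite /r; field; rewrite pi0 la0.
Qed.

(* A positive escape probability [1 - a] would make [g j / pi j] tend to [-oo]. *)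
Let a_eq1 : a = 1.
Proof.
apply/eqP; rewrite eq_le a_le1/= leNgt; apply/negP => a_lt1.
(* [C] collects the terms of [g_sum] below [n]; those from [n] on equal [- (1 - a) * r i], and
   [g j >= 0] bounds their total. *)
pose C := \sum_(m <= i < n) (a - (n <= i)%N%:R) * r i.
have bnd j : (n <= j)%N -> (1 - a) * (series r j - series r n) <= C.
  move=> nj; have : 0 <= \sum_(m <= i < j) (a - (n <= i)%N%:R) * r i.
    rewrite -(@pmulr_rge0 _ (pi_weight lam mu j)) ?pi_weight_gt0//.
    by rewrite -g_sum ?g_ge0// (leq_trans (ltnW ltmn)).
  rewrite (big_cat_nat (n := n))//=; last exact: ltnW.
  rewrite -/C => C0; rewrite -(subr_ge0 _ C); apply: le_trans C0 _.
  rewrite lerD2l -mulrN opprB /series/= [X in _ * (_ - X)](big_cat_nat (n := n))//=.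
  rewrite opprD addNKr mulrN mulr_sumr -sumrN le_eqVlt; apply/orP; left.
  apply/eqP; apply: eq_big_nat => i /andP[ni _]; rewrite ni/=; ring.
(* This threshold makes the left side of [bnd] at least [C + 1]. *)
have /cvgryPge/(_ ((C + 1) / (1 - a) + series r n)) [N _ NP] := recurrent.
have /= := NP (maxn N n) (leq_maxl _ _).
have a1 : 0 < 1 - a by rewrite subr_gt0.
rewrite -/r -lerBrDr ler_pdivrMr// mulrC => H.
have := le_trans H (bnd _ (leq_maxr N n)); lra.
Qed.

(** With [a = 1] the terms of [g_sum] from index [n] on vanish, which stops the sum at
    [minn i n]. *)
Lemma green_function i :
  series (fun k => if i == m then 0 else h k i / (lam i + mu i)) @ \oo -->
  pi_weight lam mu i *
    \sum_(m <= j < minn i n) 1 / (lam j * pi_weight lam mu j).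
Proof.
have -> : pi_weight lam mu i * \sum_(m <= j < minn i n) r j = g i.
  have [im|mi] := leqP i m.
    by rewrite g_low// big_geq ?mulr0// geq_min im.
  rewrite g_sum 1?ltnW//; congr (_ * _).
  have mmin : (m <= minn i n)%N by rewrite leq_min ltnW//= ltnW.
  rewrite [RHS](big_cat_nat (n := minn i n))//= ?geq_minl//.
  rewrite [X in _ = _ + X]big_nat_cond [X in _ = _ + X]big1 ?addr0; last first.
    move=> k; rewrite andbT => /andP[]; rewrite geq_min => /orP[|nk] ki.
      by move=> /leq_trans/(_ ki); rewrite ltnn.
    by rewrite nk a_eq1 subrr mul0r.
  apply: eq_big_nat => k /andP[_]; rewrite leq_min => /andP[_ kn].
  by rewrite leqNgt kn subr0 a_eq1 mul1r.
exact: g_cvg.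
Qed.

Lemma absorption_probability : series (h ^~ m) @ \oo --> (1 : R).
Proof. by rewrite -a_eq1; exact: h_cvg. Qed.

End Green.
End RatesLemmas.

(* The expected cost, at rate [f], of the passage from [j.+1] to [j]. *)
Definition excursion (R : realType) (lam mu f : nat -> R) (j : nat) : R :=
  (limn (series (fun i => f i * pi_weight lam mu i)) -
   series (fun i => f i * pi_weight lam mu i) j.+1) /
  (lam j * pi_weight lam mu j).

Lemma excursionB (R : realType) (lam mu f g : nat -> R) (j : nat) :
  cvgn (series (fun i => f i * pi_weight lam mu i)) ->
  cvgn (series (fun i => g i * pi_weight lam mu i)) ->
  excursion lam mu (f \- g) j = excursion lam mu f j - excursion lam mu g j.
Proof.
move=> cf cg; rewrite /excursion -mulrBl; congr (_ / _).
rewrite (_ : (fun i => _) = (fun i => f i * pi_weight lam mu i) -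
    (fun i => g i * pi_weight lam mu i)); last first.
  by apply/funext => i; rewrite /= mulrBl.
rewrite lim_seriesB// /series/= sumrB; ring.
Qed.

(** Exchange of sums: each [j] collects the states [i > j], whose weighted costs form the tail in
    [excursion]. Only finitely many [j] occur, so for [N >= n] the partial sum is the finite
    combination [s N]. *)
Lemma excursion_series (R : realType) (lam mu f : nat -> R) (m n : nat) :
  cvgn (series (fun i => f i * pi_weight lam mu i)) ->
  series (fun i => f i * (pi_weight lam mu i *
    \sum_(m <= j < minn i n) 1 / (lam j * pi_weight lam mu j))) @ \oo -->
  \sum_(m <= j < n) excursion lam mu f j.
Proof.
set a := fun i => f i * pi_weight lam mu i => ca.
pose r j := 1 / (lam j * pi_weight lam mu j).
pose s N := \sum_(m <= j < n) (series a N - series a j.+1) * r j.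
have s_cvg : s @ \oo --> \sum_(m <= j < n) excursion lam mu f j.
  apply: cvg_big => [|j _]; first exact: add_continuous.
  rewrite /excursion /r div1r; apply: cvgM; last exact: cvg_cst.
  by apply: cvgB => //; exact: cvg_cst.
apply: cvg_trans s_cvg; apply: near_eq_cvg.
exists n => // N /= nN; rewrite /s /series/=.
transitivity (\sum_(0 <= i < N) \sum_(m <= j < n) (if (j < i)%N then a i * r j else 0)).
  rewrite exchange_big_nat/=; apply: eq_big_nat => j /andP[_ jn].
  have jN : (j.+1 <= N)%N by exact: leq_trans nN.
  rewrite [X in (X - _) * _](big_cat_nat (n := j.+1))//= addrAC subrr add0r mulr_suml.
  rewrite [RHS](big_cat_nat (n := j.+1))//= [X in _ = X + _]big_nat [X in _ = X + _]big1 ?add0r.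
    by apply: eq_big_nat => i /andP[-> _].
  by move=> i /andP[_ ij]; rewrite ltnNge -ltnS ij.
apply: eq_bigr => i _; rewrite mulrA -/(a i) mulr_sumr.
rewrite (big_nat_widen m (minn i n) n)/= ?geq_minr// [RHS]big_mkcond/=.
by apply: eq_big_nat => j /andP[_ jn]; rewrite leq_min jn andbT.
Qed.

Lemma eseries_EFin (R : realType) (a : nat -> R) (l : R) :
  series a @ \oo --> l -> (\sum_(i <oo) (a i)%:E = l%:E)%E.
Proof.
move=> al; apply: cvg_lim => //; apply: cvg_EFin.
  by apply: nearW => k; rewrite sumEFin.
by under eq_fun do rewrite /= sumEFin.
Qed.

(** * Integration and path events *)

Section AeIntegral.
Import HBNNSimple.
Context {d} {T : measurableType d} {R : realType}.
Variable P : {measure set T -> \bar R}.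
Local Open Scope ereal_scope.

(* [f] itself need not be measurable: its integral is a lower integral. *)
Lemma ge0_integral_ae_eq_measurable (f g : T -> \bar R) :
  measurable_fun setT g -> (forall x, 0 <= f x) -> (forall x, 0 <= g x) ->
  {ae P, forall x, f x = g x} -> \int[P]_x f x = \int[P]_x g x.
Proof.
move=> mg f0 g0 [N [mN PN sN]].
have fg x : ~ N x -> f x = g x.
  by move=> Nx; apply: contrapT => fgx; apply: Nx; exact: sN.
have mD : measurable (setT `\` N) by exact: measurableD.
apply/eqP; rewrite eq_le; apply/andP; split.
  rewrite ge0_integralTE//; apply: ge_ereal_sup => _ [u /= uf <-].
  have mu : measurable_fun setT (EFin \o u) by exact/measurable_EFinP.
  have u0 x : 0 <= (EFin \o u) x by rewrite lee_fin.
  rewrite -integralT_nnsfun (@ge0_negligible_integral _ _ _ P _ N (EFin \o u))//.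
  rewrite (@ge0_negligible_integral _ _ _ P _ N g)//.
  apply: ge0_le_integral => //.
  - exact: measurable_funTS.
  - exact: measurable_funTS.
  - by move=> x [_ Nx]; rewrite -fg// uf.
rewrite (@ge0_negligible_integral _ _ _ P _ N g)// integral_mkcond.
rewrite ge0_integralTE; last by move=> x; apply: erestrict_ge0.
(* A simple function below [g] restricted to the complement of [N] is below [f] everywhere, as [f]
   is nonnegative on [N]. *)
rewrite ge0_integralTE//; apply: ge_ereal_sup => _ [u /= ug <-].
apply: ereal_sup_ubound; exists u => // x; apply: le_trans (ug x) _; rewrite patchE.
by case: ifPn => // /set_mem[_ /fg ->].
Qed.

Lemma integral_ae_eq_measurable (f g : T -> \bar R) : measurable_fun setT g ->
  {ae P, forall x, f x = g x} -> \int[P]_x f x = \int[P]_x g x.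
Proof.
move=> mg fg; rewrite integralE [RHS]integralE; congr (_ - _);
    apply: ge0_integral_ae_eq_measurable => //.
- exact: measurable_funepos.
- by apply: filterS fg => x fgx; rewrite !funeposE fgx.
- exact: measurable_funeneg.
- by apply: filterS fg => x fgx; rewrite !funenegE fgx.
Qed.

End AeIntegral.

(** * Path events of the jump chain *)

Section Cylinders.
Context {d} {T : measurableType d} {R : realType}.
Local Open Scope ereal_scope.

(** A predicate on set functions, so that restrictions, multiples and indefinite integrals of a
    measure can be compared without being packaged as measures. *)
Definition countably_additive (nu : set T -> \bar R) :=
  nu set0 = 0 /\ forall F : (set T)^nat, (forall i, measurable (F i)) ->
    trivIset setT F -> nu (\bigcup_i F i) = \sum_(i <oo) nu (F i).

Lemma countably_additive_measure (P : {measure set T -> \bar R}) :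
  countably_additive P.
Proof.
split=> // F mF tF; rewrite measure_semi_bigcup//; exact: bigcup_measurable.
Qed.

Lemma countably_additiveI (nu : set T -> \bar R) (B : set T) : measurable B ->
  countably_additive nu -> countably_additive (fun A => nu (A `&` B)).
Proof.
move=> mB [nu0 nuU]; split=> [|F mF tF]; first by rewrite set0I.
rewrite setI_bigcupl nuU//; last exact: trivIset_setIr.
by move=> i; exact: measurableI.
Qed.

Lemma countably_additiveZ (P : {measure set T -> \bar R}) (r : R) :
  countably_additive (fun A => P A * r%:E).
Proof.
have [P0 PU] := countably_additive_measure P.
split=> [|F mF tF]; first by rewrite P0 mul0e.
rewrite PU// muleC -nneseriesZl//.
by apply: eq_eseriesr => i _; rewrite muleC.
Qed.

Lemma countably_additive_integral (P : {measure set T -> \bar R})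
    (f : T -> \bar R) : measurable_fun setT f -> (forall x, 0 <= f x) ->
  countably_additive (fun A => \int[P]_(x in A) f x).
Proof.
move=> mf f0; split=> [|F mF tF]; first by rewrite integral_set0.
rewrite ge0_integral_bigcup//; exact: measurable_funTS.
Qed.

Variable Y : nat -> {mfun T >-> nat}.

Lemma measurable_Y (j : nat) (A : set nat) : measurable (Y j @^-1` A).
Proof. exact: measurable_funPTI. Qed.

(* [r] counts the leading coordinates that are only required to satisfy [Q]. *)
Definition cylinder (k r : nat) (Q : pred nat) (y : nat -> nat) : set T :=
  [set w | forall j, (j <= k)%N -> if (j < r)%N then Q (Y j w) : Prop else Y j w = y j].

Lemma measurable_cylinder k r Q y : measurable (cylinder k r Q y).
Proof.
rewrite (_ : cylinder _ _ _ _ = \bigcap_(j in [set j | (j <= k)%N])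
    Y j @^-1` (if (j < r)%N then [set v | Q v] else [set y j])).
  by apply: bigcap_measurable => [|j _]; [exists k; exact: leqnn|exact: measurable_Y].
by apply/seteqP; split=> w /= H j /H /=; case: ifP.
Qed.

Let update (y : nat -> nat) r v j := if j == r then v else y j.

Let slice k r Q y v :=
  if Q v then cylinder k r Q (update y r v) else set0.

Let measurable_slice k r Q y v : measurable (slice k r Q y v).
Proof. by rewrite /slice; case: ifP => // _; exact: measurable_cylinder. Qed.

Let trivIset_slice k r Q y : (r <= k)%N -> trivIset setT (slice k r Q y).
Proof.
move=> rk; apply/trivIsetP => i j _ _ /eqP ij; apply/seteqP; split=> // w [].
rewrite /slice; case: ifP => // _ Hi; case: ifP => // _ Hj; apply: ij.
by have := Hi r rk; have := Hj r rk; rewrite ltnn /update eqxx => -> ->.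
Qed.

Let cylinderS k r Q y : (r <= k)%N ->
  cylinder k r.+1 Q y = \bigcup_v slice k r Q y v.
Proof.
move=> rk; apply/seteqP; split=> w /=.
  move=> H; exists (Y r w) => //; rewrite /slice.
  have := H r rk; rewrite ltnS leqnn => -> j jk.
  have := H j jk; rewrite ltnS (leq_eqVlt j) /update.
  by case: (ltngtP j r) => //= ->.
move=> [v _]; rewrite /slice; case: ifP => // Qv H j jk.
have := H j jk; rewrite ltnS (leq_eqVlt j) /update.
by case: (ltngtP j r) => //= _ ->.
Qed.

(** The laws are given on fully prescribed paths. Coordinates are freed one at a time, each cylinder
    being a countable disjoint union of slices by the value of the freed coordinate; the last
    coordinate stays equal to [v]. *)
Lemma countably_additive_cylinder (nu1 nu2 : set T -> \bar R)
    (k v : nat) (Q : pred nat) :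
  countably_additive nu1 -> countably_additive nu2 ->
  (forall y, y k = v -> nu1 (cylinder k 0 Q y) = nu2 (cylinder k 0 Q y)) ->
  forall r y, (r <= k)%N -> y k = v ->
    nu1 (cylinder k r Q y) = nu2 (cylinder k r Q y).
Proof.
move=> [nu10 nu1U] [nu20 nu2U] nu12; elim=> [|r IH] y rk yv; first exact: nu12.
have rk' := ltnW rk.
have mS := measurable_slice k r Q y; have tS := @trivIset_slice k r Q y rk'.
rewrite cylinderS// nu1U// nu2U//.
apply: eq_eseriesr => i _; rewrite /slice; case: ifP => _; last by rewrite nu10.
by apply: IH => //; rewrite /update gtn_eqF.
Qed.

(* Occupying [j] after [k] jumps, all of whose earlier states satisfy [Q]. *)
Definition visit (Q : pred nat) (k j : nat) := cylinder k k Q (fun=> j).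

Lemma measurable_visit Q k j : measurable (visit Q k j).
Proof. exact: measurable_cylinder. Qed.

Lemma visitP Q k j w :
  visit Q k j w <-> (forall i, (i < k)%N -> Q (Y i w)) /\ Y k w = j.
Proof.
split=> [H|[H1 H2] i].
  split=> [i ik|]; first by have := H i (ltnW ik); rewrite ik.
  by have := H k (leqnn k); rewrite ltnn.
by rewrite leq_eqVlt => /orP[/eqP ->|ik]; rewrite ?ltnn// ik; exact: H1.
Qed.

Lemma trivIset_visit_state Q k : trivIset setT (visit Q k).
Proof.
apply/trivIsetP => i j _ _ /eqP ij; apply/seteqP; split=> // w [].
by move=> /visitP[_ Yi] /visitP[_ Yj]; apply: ij; rewrite -Yi.
Qed.

(** As [Q] excludes [j], the event is a first visit to [j] at jump [k]. *)
Lemma trivIset_visit_time (Q : pred nat) j : ~~ Q j ->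
  trivIset setT (fun k => visit Q k j).
Proof.
move=> Qj; apply/trivIsetP => k l _ _ /eqP kl; apply/seteqP; split=> // w [].
move=> /visitP[Hk Yk] /visitP[Hl Yl].
have [kl'|lk'|//] := ltngtP k l.
- by have := Hl _ kl'; rewrite Yk (negbTE Qj).
- by have := Hk _ lk'; rewrite Yl (negbTE Qj).
Qed.

Lemma visitS Q k j : visit Q k.+1 j =
  \bigcup_i (if Q i then visit Q k i `&` Y k.+1 @^-1` [set j] else set0).
Proof.
apply/seteqP; split=> w.
  move=> /visitP[H Yj]; exists (Y k w) => //; rewrite H//; split=> //.
  by apply/visitP; split=> // i ik; apply: H; exact: ltnW.
case=> i _; case: ifP => // Qi [/visitP[H Yi] Yj]; apply/visitP; split=> // l.
by rewrite ltnS leq_eqVlt => /orP[/eqP ->|]; [rewrite Yi|exact: H].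
Qed.

End Cylinders.

(** * Mean of a variable with exponential tail *)

Section ExponentialTail.
Context {d} {T : measurableType d} {R : realType}.
Variable P : probability T R.
Local Open Scope ereal_scope.

(** Layer-cake formula: the tail of [Z] on [A] is [P A / q] times the exponential density of rate
    [q], whose integral is 1. The positive part makes the variable nonnegative everywhere. *)
Lemma exponential_tail_integral (A : set T) (Z : {mfun T >-> R}) (q : R) :
  measurable A -> (0 < q)%R ->
  (forall s, (0 <= s)%R ->
    P (A `&` [set w | (s < Z w)%R]) = P A * (expR (- q * s))%:E) ->
  \int[P]_(w in A) (Z^\+%R w)%:E = P A * (q^-1)%:E.
Proof.
move=> mA q0 tail.
have mX : measurable_fun setT (fun w => Z^\+ w * \1_A w)%R.
  by apply: measurable_funM => //; exact: measurable_indic.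
pose X : {RV P >-> R} := mfun_Sub (mem_set mX).
have XE w : X w = (Z^\+ w * \1_A w)%R by [].
have -> : \int[P]_(w in A) (Z^\+%R w)%:E = 'E_P[X].
  rewrite expectation_def integral_mkcond; apply: eq_integral => w _.
  by rewrite /= patchE indicE; case: ifP; rewrite ?mulr1 ?mulr0.
rewrite ge0_expectation_ccdf; last first.
  by move=> w; rewrite XE mulr_ge0 ?funrpos_ge0.
have PAE : P A = (fine (P A))%:E by rewrite fineK// fin_num_measure.
transitivity (\int[@lebesgue_measure R]_(r in `[0%R, +oo[)
    ((fine (P A) * q^-1)%:E * (exponential_pdf q r)%:E)).
  apply: eq_integral => r; rewrite inE/= in_itv/= andbT => r0.
  rewrite exponential_pdfE// -EFinM -mulrA mulKf ?gt_eqF// EFinM -PAE -tail//.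
  rewrite /ccdf/= /pushforward; congr (P _); apply/seteqP; split=> w /=;
    rewrite in_itv/= andbT indicE /funrpos/=.
    have [wA|wA] := boolP (w \in A); last by rewrite mulr0 ltNge r0.
    rewrite mulr1 lt_max => /orP[rZ|]; last by rewrite ltNge r0.
    by split=> //; rewrite inE in wA.
  by move=> [wA rZ]; rewrite mem_set// mulr1 lt_max rZ.
rewrite ge0_integralZl//; last 3 first.
- apply/measurable_EFinP/measurable_funTS; exact: measurable_exponential_pdf.
- by move=> r _; rewrite lee_fin exponential_pdf_ge0// ltW.
- by rewrite lee_fin mulr_ge0// ?invr_ge0 ?fine_ge0// ltW.
rewrite [X in _ * X](_ : _ = 1) ?mule1 ?EFinM -?PAE//.
rewrite -(integral_exponential_pdf q0) integral_mkcond.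
apply: eq_integral => r _; rewrite patchE; case: ifP => // /negP r0.
by rewrite /exponential_pdf patchE; case: ifP.
Qed.

End ExponentialTail.

(** * Hitting time and cost along one path *)

Section Path.
Context {R : realType} {U : Type}.
Variables (X : R -> U -> nat) (w : U) (y : nat -> nat) (s : nat -> R).
Variables (m K : nat).
Hypothesis s_gt0 : forall k, 0 < s k.
Hypothesis X_step : forall k t, series s k <= t < series s k.+1 -> X t w = y k.
Hypothesis y_neq : forall i, (i < K)%N -> y i != m.
Hypothesis yK : y K = m.

Let s_ge0 k : 0 <= s k. Proof. exact: ltW. Qed.

Let seriesS k : series s k.+1 = series s k + s k.
Proof. by rewrite /series/= big_nat_recr. Qed.

Let series0 : series s 0 = 0.
Proof. by rewrite /series/= big_geq. Qed.

Let series_ge0 k : 0 <= series s k.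
Proof. exact: sumr_ge0. Qed.

(** The path avoids [m] on the first [K] holding intervals; the infimum is attained because the next
    interval contains its left endpoint. *)
Lemma hitting_time_path : hitting_time X m w = (series s K)%:E.
Proof.
have X_neq t : 0 <= t -> t < series s K -> X t w <> m.
  move=> t0; elim: K y_neq => [_|k IH yneq]; first by rewrite series0 ltNge t0.
  have [tk _|kt tk] := ltP t (series s k).
    by apply: IH => // i ik; apply: yneq; exact: ltnW.
  by rewrite (@X_step k) ?kt//; apply/eqP; exact: yneq.
apply/eqP; rewrite eq_le; apply/andP; split.
  apply: ereal_inf_lbound; exists (series s K) => //; split=> //.
  by rewrite (@X_step K) ?lexx/= ?seriesS ?ltrDl.
apply: le_ereal_inf_tmp => _ [t [t0 Xt] <-].
by rewrite lee_fin leNgt; apply/negP => /(X_neq _ t0).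
Qed.

Lemma occupation_integral_path (f : nat -> R) : (forall i, 0 <= f i) ->
  (\int[@lebesgue_measure R]_(t in
      [set t : R | (0 <= t)%R /\ (t%:E < hitting_time X m w)%E]) (f (X t w))%:E =
   (\sum_(0 <= i < K) f (y i) * s i)%:E)%E.
Proof.
move=> f0; rewrite hitting_time_path.
rewrite (_ : [set t | _] = `[0, series s K[%classic); last first.
  apply/seteqP; split=> t /=; rewrite in_itv/= lte_fin; first by move=> [-> ->].
  by move=> /andP[-> ->].
(* Measurability is carried through the induction because additivity over adjacent intervals
   requires it. *)
suff : measurable_fun `[0, series s K[%classic (fun t => (f (X t w))%:E) /\
    (\int[@lebesgue_measure R]_(t in `[0%R, series s K[) (f (X t w))%:E =
    (\sum_(0 <= i < K) f (y i) * s i)%:E)%E by case.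
elim: K => [|k [mf IH]].
  rewrite series0 set_itvxx integral_set0 big_geq//.
  by split=> //; exact: measurable_fun_set0.
have -> : `[0, series s k.+1[%classic =
    `[0, series s k[%classic `|` `[series s k, series s k.+1[%classic.
  by rewrite -itv_bndbnd_setU//= bnd_simp// seriesS lerDl.
have Xk : {in `[series s k, series s k.+1[%classic,
    cst (f (y k))%:E =1 (fun t => (f (X t w))%:E)}.
  by move=> t; rewrite inE/= in_itv/= => /X_step ->.
have mk : measurable_fun `[series s k, series s k.+1[%classic
    (fun t => (f (X t w))%:E).
  by apply: eq_measurable_fun Xk _; exact: measurable_cst.
have mU : measurable_fun
    (`[0, series s k[ `|` `[series s k, series s k.+1[)%classic
    (fun t => (f (X t w))%:E).
  by apply/measurable_funU.
split=> //; rewrite ge0_integral_setU//=; last 2 first.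
- by move=> t _; rewrite lee_fin.
- apply/eqP/seteqP; split=> // t [] /=; rewrite !in_itv/= => /andP[_ tk].
  by rewrite leNgt tk.
rewrite IH big_nat_recr//= EFinD; congr (_ + _)%E.
rewrite (eq_integral (cst (f (y k))%:E)); last by move=> t /Xk.
rewrite integral_cst//= lebesgue_measure_itv/= lte_fin.
by rewrite seriesS ltrDl s_gt0 -EFinD addrAC subrr add0r.
Qed.

End Path.

(** * Mean hitting times and costs *)

Section JumpChain.
Context {R : realType} {lam mu : nat -> R}.
Context {d} {T : measurableType d}.
Variables (P : probability T R) (Y : nat -> {mfun T >-> nat})
  (S : nat -> {mfun T >-> R}) (n : nat).
Hypothesis lam_gt0 : forall n, 0 < lam n.
Hypothesis mu_gt0 : forall n, 0 < mu n.+1.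
Hypothesis mu0 : mu 0%N = 0.
Hypothesis Y_law : forall (k : nat) (y : nat -> nat),
  P [set w | forall j, (j <= k)%N -> Y j w = y j] =
  ((y 0%N == n)%:R * \prod_(0 <= j < k) jump_prob lam mu (y j) (y j.+1))%:E.
Hypothesis S_law : forall (k : nat) (y : nat -> nat) (s : nat -> R),
  (forall j, 0 <= s j) ->
  P [set w | forall j, (j <= k)%N -> Y j w = y j /\ s j < S j w] =
  (P [set w | forall j, (j <= k)%N -> Y j w = y j] *
   (\prod_(0 <= j < k.+1) expR (- (lam (y j) + mu (y j)) * s j))%:E)%E.
Local Open Scope ereal_scope.

Let q_gt0 i : (0 < lam i + mu i)%R.
Proof. by case: i => [|i]; rewrite ?mu0 ?addr0// addr_gt0. Qed.

(** On a prescribed path, [Y_law] at [k] and at [k.+1] differ by one factor;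
    [countably_additive_cylinder] then forgets the past. *)
Lemma markov_property Q k i j :
  P (visit Y Q k i `&` Y k.+1 @^-1` [set j]) =
  P (visit Y Q k i) * (jump_prob lam mu i j)%:E.
Proof.
have mB := measurable_Y Y k.+1 [set j].
apply: (countably_additive_cylinder (Y := Y) (v := i)
  (nu1 := fun A => P (A `&` Y k.+1 @^-1` [set j]))
  (nu2 := fun A => P A * (jump_prob lam mu i j)%:E)) => //.
- exact: (countably_additiveI (nu := P) mB (countably_additive_measure P)).
- exact: countably_additiveZ.
move=> y yk; pose y' l := if (l <= k)%N then y l else j.
have -> : cylinder Y k 0 Q y `&` Y k.+1 @^-1` [set j] =
    [set w | forall l, (l <= k.+1)%N -> Y l w = y' l].
  apply/seteqP; split=> w /=.
    move=> [H Yj] l; rewrite /y' leq_eqVlt ltnS => /orP[/eqP ->|lk].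
      by rewrite ltnn.
    by rewrite lk; exact: H.
  move=> H; split=> [l lk|]; last by rewrite H// /y' ltnn.
  by have := H l (leqW lk); rewrite /y' lk.
have -> : P (cylinder Y k 0 Q y) =
  ((y 0%N == n)%:R * \prod_(0 <= j < k) jump_prob lam mu (y j) (y j.+1))%:E.
  exact: Y_law.
rewrite Y_law -EFinM big_nat_recr//= mulrA /y' leqnn ltnn yk/=.
congr ((_ * _ * _)%:E).
by apply: eq_big_nat => l /andP[_ lk]; rewrite lk ltnW.
Qed.

(* Chapman-Kolmogorov for the chain killed outside of [Q]. *)
Lemma visit_recurrence (Q : pred nat) k j :
  let h := fun k i => fine (P (visit Y Q k i)) in
  let v := fun k i => if Q i then (h k i / (lam i + mu i))%R else 0%R in
  h k.+1 j = ((if j is j'.+1 then lam j' * v k j' else 0) + mu j.+1 * v k j.+1)%R.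
Proof.
move=> h v.
have hE k' i : P (visit Y Q k' i) = (h k' i)%:E.
  by rewrite /h fineK// fin_num_measure//; exact: measurable_visit.
(* The jump rate from [i] to [j]: [v k i * rate i] is the mass that the killed chain sends from [i]
   to [j]. *)
pose rate i := (if j == i.+1 then lam i else if j.+1 == i then mu i else 0)%R.
have E : P (visit Y Q k.+1 j) = \sum_(i <oo) (v k i * rate i)%:E.
  rewrite visitS measure_semi_bigcup//.
  - apply: eq_eseriesr => i _; rewrite /v /rate; case: ifP => _.
      transitivity (P (visit Y Q k i) * (jump_prob lam mu i j)%:E).
        exact: markov_property.
      rewrite hE -EFinM /jump_prob; congr EFin.
      have := q_gt0 i; move: (lam i + mu i)%R => q /lt0r_neq0 q0.
      by case: ifP => _; [|case: ifP => _]; field.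
    by rewrite measure0 mul0r.
  - move=> i; case: ifP => // _.
    by apply: measurableI; [exact: measurable_visit|exact: measurable_Y].
  - apply/trivIsetP => a b _ _ /eqP ab; apply/seteqP; split=> // w [].
    case: ifP => // _ [+ _]; case: ifP => // _ + [+ _].
    by move=> /visitP[_ Ya] /visitP[_ Yb]; apply: ab; rewrite -Ya.
  - apply: bigcup_measurable => i _; case: ifP => // _.
    by apply: measurableI; [exact: measurable_visit|exact: measurable_Y].
have rv_ge0 i : 0 <= (v k i * rate i)%:E.
  rewrite lee_fin mulr_ge0//.
    by rewrite /v; case: ifP => // _; rewrite divr_ge0// ?fine_ge0// ltW.
  rewrite /rate; case: ifP => _; first exact: ltW.
  by case: ifP => // /eqP <-; exact: ltW.
(* Only the neighbours of [j] feed it, so the series stops at [j.+1]. *)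
have H : h k.+1 j = (\sum_(0 <= i < j.+2) (v k i * rate i))%R.
  apply: EFin_inj; rewrite -hE E (nneseries_split _ j.+2)// add0n eseries0 ?adde0 ?sumEFin//.
  move=> i ij _; rewrite /rate (@ltn_eqF j i.+1) ?(ltn_eqF ij) ?mulr0// ltnS.
  exact/ltnW/ltnW.
have j1 : (j == j.+1) = false by rewrite ltn_eqF.
have j2 : (j == j.+2) = false by rewrite ltn_eqF// ltnW.
rewrite H big_nat_recr//= big_nat_recr//= /rate eqxx j1 j2 eq_sym j1.
rewrite mulr0 addr0 [(mu _ * _)%R]mulrC; congr (_ + _)%R.
case: (j) => [|j']; first by rewrite big_geq.
rewrite big_nat_recr//= eqxx big1_seq ?add0r 1?mulrC// => i.
rewrite mem_index_iota => /andP[_ ij].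
by rewrite eqSS gtn_eqF// gtn_eqF ?mulr0// ltnW// ltnW.
Qed.

Let visitT k : [set: T] = \bigcup_v visit Y predT k v.
Proof.
apply/seteqP; split=> // w _; exists (Y k w) => //.
by apply/visitP; split.
Qed.

(** Zero thresholds in [S_law] keep the full probability of each prescribed path, and the visits at
    jump [k] partition the space. *)
Lemma holding_time_gt0 : {ae P, forall w, forall k, (0 < S k w)%R}.
Proof.
apply: ae_foralln => k; pose G j := S j @^-1` `]0%R, +oo[%classic.
have mG j : measurable (G j) by exact: measurable_funPTI.
have PG : P (G k) = 1.
  rewrite -(@probability_setT _ _ _ P) (visitT k) -(setTI (G k)) (visitT k).
  rewrite setI_bigcupl !measure_semi_bigcup//.
  - apply: eq_eseriesr => v _.
    apply: (countably_additive_cylinder (Y := Y) (v := v)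
      (nu1 := fun A => P (A `&` G k)) (nu2 := P)) => //.
    + exact: (countably_additiveI (nu := P) (mG k) (countably_additive_measure P)).
    + exact: countably_additive_measure.
    move=> y yv; have mC := measurable_cylinder Y k 0 predT y.
    apply/eqP; rewrite eq_le measureIl//=.
    have := @S_law k y (fun=> 0%R) (fun=> lexx _).
    rewrite big1 ?mule1; last by move=> i _; rewrite mulr0 expR0.
    rewrite /cylinder => <-; apply: le_measure; rewrite ?inE.
    + rewrite (_ : [set w | _] = cylinder Y k 0 predT y `&`
          \bigcap_(j in [set j | (j <= k)%N]) G j).
        apply: measurableI => //; apply: bigcap_measurable => [|j _//].
        by exists k; exact: leqnn.
      apply/seteqP; split=> w /= H; last first.
        move=> j jk; split; first exact: (H.1 j).
        by have := H.2 j jk; rewrite /G/= in_itv/= andbT.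
      split=> j jk; have [Yj Sj] := H j jk => //.
      by rewrite /G/= in_itv/= andbT.
    + exact: measurableI.
    + move=> w H; split=> [j jk|]; first by have [] := H j jk.
      by have [_] := H k (leqnn k); rewrite /G/= in_itv/= andbT.
  - by move=> i; exact: measurable_visit.
  - exact: trivIset_visit_state.
  - by apply: bigcup_measurable => i _; exact: measurable_visit.
  - by move=> i; apply: measurableI => //; exact: measurable_visit.
  - by apply: trivIset_setIr; exact: trivIset_visit_state.
  - apply: bigcup_measurable => i _; apply: measurableI => //.
    exact: measurable_visit.
exists (~` G k); split; first exact: measurableC.
  by have := probability_setC P (mG k); rewrite PG subee.
by move=> w /=; apply: contra_not; rewrite /G/= in_itv/= andbT.
Qed.

(** Apply [S_law] with threshold [s] at [k] and 0 before: positivity of the earlier holding times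
    removes only a null set. *)
Lemma holding_time_tail k y s (Q : pred nat) : (0 <= s)%R ->
  P (cylinder Y k 0 Q y `&` [set w | (s < S k w)%R]) =
  P (cylinder Y k 0 Q y) * (expR (- (lam (y k) + mu (y k)) * s))%:E.
Proof.
move=> s0; pose s' j := if j == k then s else 0%R.
pose A := [set w | forall j, (j <= k)%N -> Y j w = y j /\ (s' j < S j w)%R].
have mS j r : measurable [set w | (r < S j w)%R].
  rewrite (_ : [set w | _] = S j @^-1` `]r, +oo[%classic).
    exact: measurable_funPTI.
  by apply/seteqP; split=> w; rewrite /= in_itv/= andbT.
have mA : measurable A.
  rewrite (_ : A = cylinder Y k 0 Q y `&`
      \bigcap_(j in [set j | (j <= k)%N]) [set w | (s' j < S j w)%R]).
    apply: measurableI; first exact: measurable_cylinder.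
    by apply: bigcap_measurable => [|j _//]; exists k; exact: leqnn.
  by apply/seteqP; split=> w H; [split=> j jk; have [] := H j jk|
    move=> j jk; split; [exact: H.1|exact: H.2]].
have mC := measurable_cylinder Y k 0 Q y.
have -> : P (cylinder Y k 0 Q y `&` [set w | (s < S k w)%R]) = P A.
  have [N [mN PN sN]] := holding_time_gt0.
  apply/eqP; rewrite eq_le; apply/andP; split; last first.
    apply: le_measure; rewrite ?inE//; first exact: measurableI.
    move=> w H; split=> [j jk|]; first by have [] := H j jk.
    by have [_] := H k (leqnn k); rewrite /s' eqxx.
  rewrite -(measureU0 mA mN PN); apply: le_measure; rewrite ?inE.
  - exact: measurableI.
  - exact: measurableU.
  move=> w [wC sSk]; have [Nw|Nw] := pselect (N w); [by right|left].
  have S0 : forall j, (0 < S j w)%R.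
    by apply: contrapT => /= S0; apply: Nw; apply: sN.
  move=> j jk; split; first exact: (wC j).
  by rewrite /s'; case: eqP => [->|].
rewrite /A S_law; last by move=> j; rewrite /s'; case: ifP.
congr (_ * _%:E); rewrite big_nat_recr//= /s' eqxx big_nat big1 ?mul1r// => i ik.
by rewrite ltn_eqF ?mulr0 ?expR0//; case/andP: ik.
Qed.

(** The exponential mean depends on a prescribed path only through its last state, so the past can
    be freed. *)
Lemma expected_holding_time Q k i :
  \int[P]_(w in visit Y Q k i) ((S k)^\+%R w)%:E =
  P (visit Y Q k i) * ((lam i + mu i)^-1)%:E.
Proof.
apply: (countably_additive_cylinder (Y := Y) (v := i)
  (nu1 := fun A => \int[P]_(w in A) ((S k)^\+%R w)%:E)
  (nu2 := fun A => P A * ((lam i + mu i)^-1)%:E)) => //.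
- apply: countably_additive_integral => [|w]; last by rewrite lee_fin funrpos_ge0.
  exact/measurable_EFinP.
- exact: countably_additiveZ.
move=> y yk; apply: exponential_tail_integral => //.
  exact: measurable_cylinder.
by move=> s s0; rewrite holding_time_tail// yk.
Qed.

(** * The chain absorbed in [m] *)

Section Absorption.
Variables (X : R -> {mfun T >-> nat}) (m : nat).
Hypothesis ltmn : (m < n)%N.
Hypothesis recurrent : (series (fun n => 1 / (lam n * pi_weight lam mu n)) @ \oo --> +oo)%R.
Hypothesis X_law : {ae P, forall w, forall (k : nat) (t : R),
  (series (fun j => S j w) k <= t < series (fun j => S j w) k.+1)%R -> X t w = Y k w}.

(** Killing at [m]: with this [Q], the numbers [h k i] below satisfy the hypotheses of the section
    [Green]. *)
Let Q : pred nat := predC1 m.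

Let h k i := fine (P (visit Y Q k i)).

Let hE k i : P (visit Y Q k i) = (h k i)%:E.
Proof. by rewrite /h fineK// fin_num_measure//; exact: measurable_visit. Qed.

Let h_ge0 k i : (0 <= h k i)%R. Proof. exact: fine_ge0. Qed.

Let h0 i : h 0%N i = (i == n)%:R%R.
Proof.
have := Y_law 0 (fun=> i); rewrite big_geq// mulr1 => E.
by apply: EFin_inj; rewrite -hE -E.
Qed.

Let v k i := if i == m then 0%R else (h k i / (lam i + mu i))%R.

Let hS k j : h k.+1 j =
  ((if j is j'.+1 then lam j' * v k j' else 0) + mu j.+1 * v k j.+1)%R.
Proof.
rewrite /h visit_recurrence /v /Q/=.
by congr (_ + _ * _)%R; [case: (j) => // j'; congr (_ * _)%R|]; case: eqP.
Qed.

Let absorbed := \bigcup_k visit Y Q k m.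

Let measurable_absorbed : measurable absorbed.
Proof. by apply: bigcup_measurable => k _; exact: measurable_visit. Qed.

Let absorbedE : P absorbed = \sum_(k <oo) (h k m)%:E.
Proof.
rewrite measure_semi_bigcup//.
- by apply: eq_eseriesr => k _; exact: hE.
- by move=> k; exact: measurable_visit.
- by apply: trivIset_visit_time; rewrite /Q/= eqxx.
Qed.

Let h_le1 K : (series (h ^~ m) K <= 1)%R.
Proof.
rewrite -lee_fin -(@probability_setT _ _ _ P).
apply: (@le_trans _ _ (P absorbed)); last by apply: le_measure; rewrite ?inE.
rewrite absorbedE /series/= -sumEFin; apply: nneseries_lim_ge => k _ _.
by rewrite lee_fin.
Qed.

Let mu00 : (0 <= mu 0%N)%R. Proof. by rewrite mu0. Qed.

Let absorbed_ae : P absorbed = 1.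
Proof.
rewrite absorbedE; apply: eseries_EFin.
exact: (absorption_probability lam_gt0 mu_gt0 ltmn mu00 recurrent).
Qed.

Let good w := (forall k, (0 < S k w)%R) /\
  (forall (k : nat) (t : R),
    (series (fun j => S j w) k <= t < series (fun j => S j w) k.+1)%R ->
    X t w = Y k w) /\ absorbed w.

Let good_ae : {ae P, forall w, good w}.
Proof.
have : {ae P, forall w, absorbed w}.
  exists (~` absorbed); split=> //; first exact: measurableC.
  by have := probability_setC P measurable_absorbed; rewrite absorbed_ae subee.
by move=> H; apply: filterS3 holding_time_gt0 X_law H => w *; split.
Qed.

Let occupation (f : nat -> R) w := \int[@lebesgue_measure R]_(t in
  [set t : R | (0 <= t)%R /\ t%:E < hitting_time X m w]) (f (X t w))%:E.

Section NonnegativeCost.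
Variable f : nat -> R.
Hypothesis f_ge0 : forall i, (0 <= f i)%R.

(** The paths not yet absorbed after [k] jumps. *)
Let D k := \bigcup_i (if Q i then visit Y Q k i else set0).

Let measurable_D k : measurable (D k).
Proof.
apply: bigcup_measurable => i _; case: ifP => // _; exact: measurable_visit.
Qed.

Let u k w := (f (Y k w) * (S k)^\+%R w)%:E.

Let u_ge0 k w : 0 <= u k w.
Proof. by rewrite lee_fin mulr_ge0// funrpos_ge0. Qed.

Let measurable_u k : measurable_fun setT (u k).
Proof.
apply/measurable_EFinP/measurable_funM => //.
exact: (measurableT_comp (f := f)).
Qed.

(** A measurable version of [occupation f]: the costs of the holding times before absorption. *)
Let g w := \sum_(k <oo) (u k \_ (D k)) w.

Let g_term_ge0 k w : 0 <= (u k \_ (D k)) w.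
Proof. by apply: erestrict_ge0 => ? _. Qed.

Let measurable_g_term k : measurable_fun setT (u k \_ (D k)).
Proof. by apply/(measurable_restrictT _ _).1 => //; exact: measurable_funTS. Qed.

Let g_ge0 w : 0 <= g w. Proof. exact: nneseries_ge0. Qed.

Let measurable_g : measurable_fun setT g.
Proof. by apply: ge0_emeasurable_sum. Qed.

Let integral_u k : \int[P]_(w in D k) u k w = \sum_(i <oo) (f i * v k i)%:E.
Proof.
rewrite ge0_integral_bigcup//.
- apply: eq_eseriesr => i _; rewrite /v /Q/=; case: eqP => [_|/eqP im]/=.
    by rewrite mulr0 integral_set0.
  rewrite (eq_integral (fun w => (f i)%:E * ((S k)^\+%R w)%:E)); last first.
    by move=> w /set_mem /visitP[_ Yi]; rewrite /u Yi.
  rewrite ge0_integralZl//.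
  + by rewrite expected_holding_time hE -!EFinM.
  + exact: measurable_visit.
  + by apply: measurable_funTS; exact/measurable_EFinP.
  + by move=> w _; rewrite lee_fin funrpos_ge0.
  + by rewrite lee_fin.
- by move=> i; case: ifP => // _; exact: measurable_visit.
- exact: measurable_funTS.
- apply/trivIsetP => a b _ _ ab; have /trivIsetP := @trivIset_visit_state _ _ Y Q k.
  move=> /(_ a b I I ab) E.
  by case: ifP => _; case: ifP => _; rewrite ?set0I ?setI0.
Qed.

(** By Tonelli the sum over jumps is taken first, state by state, where it gives the Green
    function. *)
Let integral_g : \int[P]_w g w = \sum_(i <oo) (f i *
  (pi_weight lam mu i * \sum_(m <= j < minn i n) 1 / (lam j * pi_weight lam mu j)))%:E.
Proof.
rewrite integral_nneseries//.
under eq_eseriesr do rewrite -integral_mkcond integral_u.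
rewrite nneseries_interchange//; last first.
  move=> k i; rewrite lee_fin mulr_ge0// /v; case: ifP => // _.
  by rewrite divr_ge0// ltW.
apply: eq_eseriesr => i _; apply: eseries_EFin.
rewrite (_ : series _ = fun K => (f i * series (v ^~ i) K)%R); last first.
  by apply/funext => K; rewrite /series/= mulr_sumr.
apply: cvgM; first exact: cvg_cst.
exact: (green_function lam_gt0 mu_gt0 ltmn mu00 recurrent).
Qed.

Let occupation_good w : good w -> occupation f w = g w.
Proof.
move=> [S0 [XY [K _ /visitP[YQ YK]]]].
rewrite /occupation (occupation_integral_path (y := Y ^~ w) (s := S ^~ w) (K := K))//.
rewrite /g (nneseries_split _ K)// add0n eseries0 ?adde0.
  rewrite -sumEFin; apply: eq_big_nat => i /andP[_ iK].
  rewrite patchE mem_set.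
    by rewrite /u /funrpos/= max_l// ltW.
  exists (Y i w) => //; rewrite YQ//; apply/visitP; split=> // j ji.
  by apply: YQ; exact: ltn_trans iK.
(* No term survives from jump [K] on: the state at [K] is [m], and later paths have [m] in their
   past. *)
move=> i Ki _; rewrite patchE memNset// => -[j _]; case: ifP => // Qj /visitP[YQ' Yj].
move: Ki; rewrite leq_eqVlt => /orP[/eqP Ki|/YQ']; last by rewrite YK /Q/= eqxx.
by move: Qj; rewrite -Yj -Ki YK /Q/= eqxx.
Qed.

Hypothesis f_summable : cvgn (series (fun i => f i * pi_weight lam mu i)%R).

(** Serves both hitting means: measurability of [occupation f] is not established, so it is handled
    through [g]. *)
Lemma occupation_ae : exists g : T -> \bar R, [/\ measurable_fun setT g,
  forall w, 0 <= g w, {ae P, forall w, occupation f w = g w} &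
  \int[P]_w g w = (\sum_(m <= j < n) excursion lam mu f j)%:E].
Proof.
exists g; split=> //; first exact: filterS occupation_good good_ae.
by rewrite integral_g; exact/eseries_EFin/excursion_series.
Qed.

End NonnegativeCost.

Hypothesis pi_summable : cvgn (series (pi_weight lam mu)).

(** On good paths the hitting time is the occupation integral of the unit cost. *)
Lemma mean_hitting_timeE :
  mean_hitting_time P X m = (\sum_(m <= j < n) excursion lam mu (fun=> 1) j)%R.
Proof.
have pi1 : cvgn (series (fun i => 1 * pi_weight lam mu i)%R).
  by under eq_fun do rewrite mul1r.
have [k [mk k0 occk Ek]] := occupation_ae (fun=> ler01) pi1.
rewrite /mean_hitting_time (ge0_integral_ae_eq_measurable (g := k))// ?Ek//.
  by move=> w; apply: le_ereal_inf_tmp => _ [t [t0 _] <-]; rewrite lee_fin.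
apply: filterS2 good_ae occk => w [S0 [XY [K _ /visitP[YQ YK]]]] <-.
have E := hitting_time_path (X := X) (w := w) (y := Y ^~ w) (s := S ^~ w)
  S0 XY YQ YK.
have := @occupation_integral_path R T X w (Y ^~ w) (S ^~ w) m K S0 XY YQ YK
  (fun=> 1%R) (fun=> ler01).
rewrite /occupation => ->.
by rewrite E; congr EFin; apply: eq_bigr => i _; rewrite mul1r.
Qed.

(** The positive and negative parts of [c] are dominated by its absolute value, so both have finite
    means, which can be subtracted. *)
Lemma mean_hitting_costE (c : nat -> R) :
  cvgn (series (fun i => `|c i| * pi_weight lam mu i)%R) ->
  mean_hitting_cost P X c m = (\sum_(m <= j < n) excursion lam mu c j)%R.
Proof.
move=> cpi.
have cp : cvgn (series (fun i => c^\+ i * pi_weight lam mu i)%R).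
  apply: series_le_cvg cpi => i.
  - by rewrite mulr_ge0// ?funrpos_ge0// ltW// pi_weight_gt0.
  - by rewrite mulr_ge0// ltW// pi_weight_gt0.
  - by rewrite ler_pM2r ?pi_weight_gt0// /funrpos/= ge_max ler_norm normr_ge0.
have cn : cvgn (series (fun i => c^\- i * pi_weight lam mu i)%R).
  apply: series_le_cvg cpi => i.
  - by rewrite mulr_ge0// ?funrneg_ge0// ltW// pi_weight_gt0.
  - by rewrite mulr_ge0// ltW// pi_weight_gt0.
  - rewrite ler_pM2r ?pi_weight_gt0// /funrneg/= ge_max normr_ge0 andbT.
    by rewrite -normrN ler_norm.
have [g1 [mg1 g10 occ1 E1]] := occupation_ae (funrpos_ge0 c) cp.
have [g2 [mg2 g20 occ2 E2]] := occupation_ae (funrneg_ge0 c) cn.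
have i1 : P.-integrable setT g1.
  apply/integrableP; split=> //.
  by under eq_integral do rewrite gee0_abs//; rewrite E1 ltry.
have i2 : P.-integrable setT g2.
  apply/integrableP; split=> //.
  by under eq_integral do rewrite gee0_abs//; rewrite E2 ltry.
rewrite /mean_hitting_cost (integral_ae_eq_measurable (g := g1 \- g2)).
- rewrite integralB// E1 E2 -EFinB/= -sumrB; apply: eq_bigr => j _.
  by rewrite -excursionB// -[X in _ = excursion _ _ X _]funrposBneg.
- exact: emeasurable_funB.
- apply: filterS2 occ1 occ2 => w <- <-.
  rewrite integralE; congr (_ - _); apply: eq_integral => t _.
    by rewrite funeposE /funrpos/= EFin_max.
  by rewrite funenegE /funrneg/= EFin_max.
Qed.

End Absorption.
End JumpChain.
(** * Forward and backward recurrences *)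

Section Recurrences.
Context {R : realType} {lam mu c : nat -> R}.
Hypothesis lam_gt0 : forall n, 0 < lam n.
Hypothesis mu_gt0 : forall n, 0 < mu n.+1.
Hypothesis pi_summable : cvgn (series (pi_weight lam mu)).
Hypothesis cost_summable : cvgn (series (fun n => `|c n| * steady lam mu n)).

Let w n := pi_weight lam mu n.
Let L := limn (series w).

Let w_gt0 n : 0 < w n. Proof. exact: pi_weight_gt0. Qed.

Let series_lt_lim n : series w n < L.
Proof.
apply: (@lt_le_trans _ _ (series w n.+1)).
  by rewrite /series/= big_nat_recr//= ltrDl.
apply: nondecreasing_cvgn_le => //.
by apply: (@nondecreasing_series _ w xpredT 0%N) => k _ _; exact: ltW.
Qed.

Let L_gt0 : 0 < L.
Proof. by have := series_lt_lim 0; rewrite /series/= big_geq. Qed.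

Lemma abs_cost_weight_summable : cvgn (series (fun n => `|c n| * w n)).
Proof.
rewrite (_ : (fun n => _) = L *: (fun n => `|c n| * steady lam mu n)).
  exact: is_cvg_seriesZ.
apply/funext => n; change (`|c n| * w n = L * (`|c n| * (w n / L))).
by field; rewrite gt_eqF.
Qed.

Let cw_summable : cvgn (series (fun n => c n * w n)).
Proof.
have E : (fun n => `|c n * w n|) = (fun n => `|c n| * w n).
  by apply/funext => n; rewrite normrM [`|w n|]ger0_norm// ltW.
by apply: normed_cvg; move: abs_cost_weight_summable; rewrite -E.
Qed.

Lemma mean_cost_weight : mean_cost lam mu c * L = limn (series (fun n => c n * w n)).
Proof.
rewrite /mean_cost (_ : (fun n => _) = L^-1 *: (fun n => c n * w n)).
  by rewrite lim_seriesZ// /GRing.scale/= mulrAC mulVf ?mul1r// gt_eqF.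
apply/funext => n; change (c n * (w n / L) = L^-1 * (c n * w n)).
by rewrite mulrA mulrC.
Qed.

Let T j := excursion lam mu (fun=> 1) j.
Let H j := excursion lam mu c j.

Let TE j : T j = (L - series w j.+1) / (lam j * w j).
Proof. by rewrite /T /excursion; under eq_fun do rewrite mul1r. Qed.

Let HE j : H j = (limn (series (fun n => c n * w n)) -
  series (fun n => c n * w n) j.+1) / (lam j * w j).
Proof. by []. Qed.

Lemma excursion_time_gt0 j : 0 < excursion lam mu (fun=> 1) j.
Proof.
rewrite -/(T j) TE divr_gt0// ?mulr_gt0//.
by rewrite subr_gt0.
Qed.

Lemma phi_excursion n : phi lam mu c n = H n - mean_cost lam mu c * T n.
Proof.
set z := mean_cost lam mu c.
have E k : lam k * w k * phi lam mu c k =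
    z * series w k.+1 - series (fun n => c n * w n) k.+1.
  elim: k => [|k IH].
    rewrite /series/= !big_nat1 addr0 -/z.
    by have /lt0r_neq0 := lam_gt0 0 => la; field.
  have seriesS (a : nat -> R) : series a k.+2 = series a k.+1 + a k.+1.
    by rewrite /series/= big_nat_recr.
  rewrite !seriesS/= -/z.
  have -> : lam k.+1 * w k.+1 * ((z - c k.+1) / lam k.+1 +
      mu k.+1 / lam k.+1 * phi lam mu c k) =
      (z - c k.+1) * w k.+1 + mu k.+1 * w k.+1 * phi lam mu c k.
    by have /lt0r_neq0 := lam_gt0 k.+1 => la; field.
  by rewrite pi_weight_balance// IH; ring.
have /lt0r_neq0 la := lam_gt0 n; have /lt0r_neq0 wn := w_gt0 n.
(* By [mean_cost_weight], [z * L] is the full weighted cost, which turns the partial sums in [E]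
   into the tails in [H] and [T]. *)
apply: (mulfI (mulf_neq0 la wn)); rewrite E TE HE -mean_cost_weight -/z.
by field; rewrite wn.
Qed.

Lemma backward_recurrence_sum zetah (f : nat -> R) N n : (n <= N)%N ->
  backward_recurrence lam mu c zetah N f ->
  lam n * w n * f n =
  \sum_(n.+1 <= j < N.+1) (c j - zetah) * w j + lam N * w N * f N.
Proof.
(* Induction on the distance to the terminal index [N]. *)
move=> nN rec; rewrite -(subKn nN); elim: (N - n)%N (leq_subr n N) => [|e IH] eN.
  by rewrite subn0 big_geq// add0r.
set i := (N - e.+1)%N; have Ei : (N - e = i.+1)%N by rewrite /i -subSn.
have iN : (i < N)%N by rewrite /i -Ei leq_subr.
rewrite rec// big_ltn//= -addrA -Ei -IH ?Ei; last exact: ltnW.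
rewrite -pi_weight_balance// -/(w i.+1).
by have /lt0r_neq0 := mu_gt0 i => m0; field.
Qed.

Lemma backward_recurrence_limit zetah (f : nat -> nat -> R) n :
  (forall N, backward_recurrence lam mu c zetah N (f N)) ->
  (lam N * steady lam mu N * f N N) @[N --> \oo] --> 0 ->
  f N n @[N --> \oo] -->
    excursion lam mu c n - zetah * excursion lam mu (fun=> 1) n.
Proof.
move=> rec term; have lw : lam n * w n != 0 by rewrite gt_eqF// mulr_gt0.
pose cw i := c i * w i.
have lim_tail (a : nat -> R) : cvgn (series a) ->
    series a N.+1 - series a n.+1 @[N --> \oo] --> limn (series a) - series a n.+1.
  by move=> ca; apply: cvgB; [rewrite cvg_shiftS|exact: cvg_cst].
(* The closed form of [f N n] for [N >= n]; the factor [L] undoes the normalisation in [steady], so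
   that the terminal hypothesis applies. *)
pose s N := ((series cw N.+1 - series cw n.+1) -
  zetah * (series w N.+1 - series w n.+1) +
  L * (lam N * steady lam mu N * f N N)) / (lam n * w n).
have -> : H n - zetah * T n = ((limn (series cw) - series cw n.+1) -
    zetah * (L - series w n.+1) + L * 0) / (lam n * w n).
  by rewrite TE HE mulr0 addr0 [RHS]mulrBl -[zetah * _ / _]mulrA.
have s_cvg : s @ \oo --> ((limn (series cw) - series cw n.+1) -
    zetah * (L - series w n.+1) + L * 0) / (lam n * w n).
  apply: cvgM; last exact: cvg_cst.
  apply: cvgD; last by apply: cvgM => //; exact: cvg_cst.
  apply: cvgB; first exact: lim_tail.
  by apply: cvgM; [exact: cvg_cst|exact: lim_tail].
apply: cvg_trans s_cvg; apply: near_eq_cvg.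
exists n => // N /= nN; apply: (mulfI lw).
rewrite (backward_recurrence_sum nN (rec N)) /s mulrC divfK//.
have tailE (a : nat -> R) :
    series a N.+1 - series a n.+1 = \sum_(n.+1 <= j < N.+1) a j.
  by rewrite /series/= (big_cat_nat (n := n.+1))//= addrAC subrr add0r.
rewrite !tailE mulr_sumr -sumrB; congr (_ + _).
  by apply: eq_bigr => j _; rewrite /cw mulrBl.
by rewrite /steady -/L -/(w N); field; rewrite gt_eqF.
Qed.

End Recurrences.

(** * Application to the birth-death chain and limits of the errors *)

Lemma birth_death_mean_hitting_time (R : realType) (lam mu : nat -> R)
    (d : measure_display) (T : measurableType d) (P : probability T R)
    (X : R -> {mfun T >-> nat}) (m n : nat) :
  (forall n, 0 < lam n) -> (forall n, 0 < mu n.+1) -> mu 0%N = 0 ->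
  series (fun n => 1 / (lam n * pi_weight lam mu n)) @ \oo --> +oo ->
  cvgn (series (pi_weight lam mu)) ->
  birth_death_chain lam mu P X n -> (m < n)%N ->
  mean_hitting_time P X m = \sum_(m <= j < n) excursion lam mu (fun=> 1) j.
Proof.
move=> lam_gt0 mu_gt0 mu0 rec pisum [Y [S [Y_law S_law X_law]]] mn.
exact: (mean_hitting_timeE lam_gt0 mu_gt0 mu0 Y_law S_law mn rec X_law).
Qed.

Lemma birth_death_mean_hitting_cost (R : realType) (lam mu c : nat -> R)
    (d : measure_display) (T : measurableType d) (P : probability T R)
    (X : R -> {mfun T >-> nat}) (m n : nat) :
  (forall n, 0 < lam n) -> (forall n, 0 < mu n.+1) -> mu 0%N = 0 ->
  series (fun n => 1 / (lam n * pi_weight lam mu n)) @ \oo --> +oo ->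
  cvgn (series (fun i => `|c i| * pi_weight lam mu i)) ->
  birth_death_chain lam mu P X n -> (m < n)%N ->
  mean_hitting_cost P X c m = \sum_(m <= j < n) excursion lam mu c j.
Proof.
move=> lam_gt0 mu_gt0 mu0 rec csum [Y [S [Y_law S_law X_law]]] mn.
exact: (mean_hitting_costE lam_gt0 mu_gt0 mu0 Y_law S_law mn rec X_law).
Qed.

Theorem proposition6p4 (R : realType) (lam mu c : nat -> R)
    (d : measure_display) (T : measurableType d)
    (P : nat -> probability T R) (X : R -> {mfun T >-> nat})
    (b0 zetah : R) (phih : nat -> nat -> R)
    (lam_gt0 : forall n, 0 < lam n)
    (mu_gt0 : forall n, 0 < mu n.+1)
    (mu0 : mu 0%N = 0)
    (recurrent :
      series (fun n => 1 / (lam n * pi_weight lam mu n)) @ \oo --> +oo)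
    (positive_recurrent : cvgn (series (pi_weight lam mu)))
    (cost_summable : cvgn (series (fun n => `|c n| * steady lam mu n)))
    (* [P n] is the law of the chain started at [n]. *)
    (chain : forall n, birth_death_chain lam mu (P n) X n)
    (zetah_neq : zetah <> mean_cost lam mu c)
    (* [phih N n] is the n-th value computed from the terminal index [N]. *)
    (backward : forall N, backward_recurrence lam mu c zetah N (phih N))
    (terminal : (lam N * steady lam mu N * phih N N) @[N --> \oo] --> 0) :
  let zeta := mean_cost lam mu c in
  let ph := phi lam mu c in
  let b := bias_of b0 ph in
  let bh := fun N => bias_of b0 (phih N) in
  let Tm := fun n => mean_hitting_time (P n) X n.-1 in
  let Hm := fun n => mean_hitting_cost (P n) X c n.-1 in
  let Zm := fun n => Hm n / Tm n in
  let T0 := fun n => mean_hitting_time (P n) X 0 in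
  let H0 := fun n => mean_hitting_cost (P n) X c 0 in
  let Z0 := fun n => H0 n / T0 n in
  [/\ forall n : nat,
        Eabs (phih N n) (ph n) @[N --> \oo] --> - Tm n.+1 * Eabs zetah zeta,
      forall n : nat, zeta <> 0 -> ph n <> 0 ->
        Erel (phih N n) (ph n) @[N --> \oo] -->
          - zeta * (Tm n.+1 / ph n) * Erel zetah zeta /\
        - zeta * (Tm n.+1 / ph n) * Erel zetah zeta =
          - (zeta / (Zm n.+1 - zeta)) * Erel zetah zeta,
      forall n : nat, (1 <= n)%N ->
        Eabs (bh N n) (b n) @[N --> \oo] --> - T0 n * Eabs zetah zeta
    & forall n : nat, (1 <= n)%N -> zeta <> 0 -> b n <> 0 ->
        Erel (bh N n) (b n) @[N --> \oo] -->
          - zeta * (T0 n / b n) * Erel zetah zeta /\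
        - zeta * (T0 n / b n) * Erel zetah zeta =
          - (zeta / (b0 / T0 n + Z0 n - zeta)) * Erel zetah zeta].
Proof.
move=> zeta ph b bh Tm Hm Zm T0 H0 Z0.
have csum := abs_cost_weight_summable lam_gt0 mu_gt0 positive_recurrent cost_summable.
pose time := excursion lam mu (fun=> 1); pose cost := excursion lam mu c.
have T0E n : (0 < n)%N -> T0 n = \sum_(0 <= j < n) time j.
  exact: (birth_death_mean_hitting_time lam_gt0 mu_gt0 mu0 recurrent
    positive_recurrent (chain n)).
have H0E n : (0 < n)%N -> H0 n = \sum_(0 <= j < n) cost j.
  exact: (birth_death_mean_hitting_cost lam_gt0 mu_gt0 mu0 recurrent csum (chain n)).
(* A descent by one level is a sum with the single index [n]. *)
have TmE n : Tm n.+1 = time n.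
  rewrite -[RHS](big_nat1 +%R n time).
  exact: (birth_death_mean_hitting_time lam_gt0 mu_gt0 mu0 recurrent
    positive_recurrent (chain n.+1)).
have HmE n : Hm n.+1 = cost n.
  rewrite -[RHS](big_nat1 +%R n cost).
  exact: (birth_death_mean_hitting_cost lam_gt0 mu_gt0 mu0 recurrent csum (chain n.+1)).
have time_gt0 n : 0 < time n by exact: excursion_time_gt0.
have phE n : ph n = cost n - zeta * time n by exact: phi_excursion.
have phih_cvg n : phih N n @[N --> \oo] --> cost n - zetah * time n.
  exact: (backward_recurrence_limit lam_gt0 mu_gt0 positive_recurrent cost_summable).
have bE n : (0 < n)%N -> b n = b0 + H0 n - zeta * T0 n.
  move=> n0; rewrite H0E// T0E// mulr_sumr -addrA -sumrB.
  by congr (_ + _); apply: eq_bigr => j _; exact: phE.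
have T0_gt0 n : (0 < n)%N -> 0 < T0 n.
  case: n => // n _; rewrite T0E// big_nat_recr//= ltr_wpDl//.
  by apply: sumr_ge0 => j _; exact: ltW.
(* The exact and limiting values share the cost term, so only the time term times the error of
   [zetah] remains. *)
have a n : Eabs (phih N n) (ph n) @[N --> \oo] --> - Tm n.+1 * Eabs zetah zeta.
  rewrite /Eabs TmE (_ : _ * _ = (cost n - zetah * time n) - ph n); last first.
    by rewrite phE; ring.
  by apply: cvgB => //; exact: cvg_cst.
have cc n : (1 <= n)%N ->
    Eabs (bh N n) (b n) @[N --> \oo] --> - T0 n * Eabs zetah zeta.
  move=> n1; rewrite /Eabs.
  rewrite (_ : - _ * _ = b0 + \sum_(0 <= j < n) (cost j - zetah * time j) - b n).
    apply: cvgB; last exact: cvg_cst.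
    apply: cvgD; first exact: cvg_cst.
    by apply: cvg_big => [|j _]; [exact: add_continuous|exact: phih_cvg].
  by rewrite sumrB -mulr_sumr bE// H0E// T0E//; ring.
split=> // n.
- move=> /eqP z0 /eqP ph0; split.
    rewrite (_ : _ * _ * _ = - Tm n.+1 * Eabs zetah zeta / ph n).
      by apply: cvgM; [exact: a|exact: cvg_cst].
    by rewrite /Erel; field; rewrite ph0 z0.
  (* The second form rests on [ph n = Tm n.+1 * (Zm n.+1 - zeta)]. *)
  have t0 : time n != 0 by rewrite gt_eqF.
  rewrite phE in ph0; rewrite /Zm HmE TmE phE; congr (_ * _); field.
  by rewrite t0 mulNr ph0.
- move=> n1 /eqP z0 /eqP bn0; split.
    rewrite (_ : _ * _ * _ = - T0 n * Eabs zetah zeta / b n).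
      by apply: cvgM; [exact: cc|exact: cvg_cst].
    by rewrite /Erel; field; rewrite bn0 z0.
  (* Likewise [b n = T0 n * (b0 / T0 n + Z0 n - zeta)]. *)
  have t0 : T0 n != 0 by rewrite gt_eqF// T0_gt0.
  rewrite bE// in bn0; rewrite /Z0 bE//; congr (_ * _); field.
  by rewrite t0 mulNr.
Qed.
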